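(* Let $\Psi$ be a fan-in $2$ noncommutative arithmetic circuit of size $s$ computing $\mathrm{Pal}_{n,n}(X,Y)$, and let $\mathcal{B}_{d'}\subseteq\mathbb{F}\langle X\rangle$ be the set constructed from $\Psi$ as described in the context. Then $$\bigl|\{v\in \mathcal{B}_{d'} \mid \pi_n(v)\neq 0\}\bigr|\le (s+n+1)\sum_{r=0}^{n}\frac{s^r}{r!}.$$
   Context: Let $\mathbb{F}$ be a field, $X=\{x_1,\dots,x_n\}$, $Y=\{y_1,\dots,y_n\}$ disjoint sets of noncommuting variables, and $\mathrm{Pal}_{n,n}(X,Y)=\sum_{(i_1,\dots,i_n)\in[n]^n} x_{i_1}\cdots x_{i_n}\,y_{i_n}\cdots y_{i_1}$. A fan-in $2$ noncommutative arithmetic circuit is a DAG whose leaves are labeled by field constants or variables, whose internal nodes (gates) are labeled $+$ or $\times$, each of in-degree exactly $2$, with designated left/right children at $\times$ gates; edges may carry field-constant weights scaling the polynomial along the edge. Size is the number of vertices. For a gate $g$, $\widehat g$ denotes the polynomial it computes. The syntactic degree $d(g)$ is defined recursively: a leaf labeled by a variable has degree $1$, a leaf labeled by a constant has degree $0$, a $+$ gate has the maximum of its children's degrees, a $\times$ gate has the sum of its children's degrees. Construction: Let $l_1<l_2<\cdots<l_{d'}$ be the distinct syntactic degrees appearing in $\Psi$. For $k\in[d']$ let $P_k$ be the set of $\times$ gates $g$ with $d(g)=l_k$. For a gate $g$, let $\widehat g_X$ be the sum (with coefficients) of all non-constant monomials of $\widehat g$ involving only variables from $X$; so $\widehat g_X\in\mathbb{F}\langle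 X\rangle$. For $k\in[d']$ let $\mathcal{M}_k=\{\widehat a_X : \text{there is a }\times\text{ gate } g\in P_k \text{ whose left child is } a\}$. Define $\mathcal{B}_1=\{1,x_1,\dots,x_n\}$ and for $2\le k\le d'$, $$\mathcal{B}_k=\mathcal{B}_{k-1}\cup\{\widehat g_X\mid g\in P_k\}\cup\{p\,h\mid p\in\mathcal{M}_k,\ h\in\mathcal{B}_{k-1}\}.$$ Finally, $\pi_n:\mathbb{F}\langle X\rangle\to\mathbb{F}\langle X\rangle$ is the linear map sending a polynomial to its homogeneous degree-$n$ component (the sum of its terms of degree exactly $n$). *)

(* Defs.v *)
From HB Require Import structures.
From mathcomp Require Import all_boot all_order all_algebra finmap.
From mathcomp Require Export monalg.

Set Implicit Arguments.
Unset Strict Implicit.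
Unset Printing Implicit Defensive.

Import GRing.Theory.
Local Open Scope ring_scope.

(* [inl i] is the variable x_i and [inr i] is the variable y_i. *)
Definition var (n : nat) := ('I_n + 'I_n)%type.

(* Free algebras: finitely supported functions on words. *)
Notation freeXY F n := {malg F[{fmonom (var n)}]}.
Notation freeX F n := {malg F[{fmonom 'I_n}]}.

Section Polynomials.
Variables (F : fieldType) (n : nat).

(* The noncommutative products below are taken in the order j = 0, ..., n-1. *)
Definition Pal : freeXY F n :=
  \sum_(i : {ffun 'I_n -> 'I_n})
    (\prod_(j < n) << fmu (inl (i j) : var n) >>) *
    (\prod_(j < n) << fmu (inr (i (rev_ord j)) : var n) >>).

Definition isX (z : var n) : bool := if z is inl _ then true else false.
Definition getX (z : var n) : option 'I_n := if z is inl i then Some i else None.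

(* The words kept consist of letters x_i only, so [pmap getX] merely relabels
   them as words over 'I_n. *)
Definition Xpart (p : freeXY F n) : freeX F n :=
  \sum_(m <- msupp p | (m != mone) && all isX m)
    << p@_m *g FMonom (pmap getX m) >>.

Definition hcomp (d : nat) (p : freeX F n) : freeX F n :=
  \sum_(m <- msupp p | fdeg m == d) << p@_m *g m >>.

Lemma XpartE p m : (Xpart p)@_m =
  if m == mone then 0 else p@_(FMonom [seq inl i | i <- m]).
Proof.
have getXK (w : {fmonom (var n)}) : all isX w ->
    FMonom [seq inl i | i <- pmap getX w] = w.
  by case: w => w /= h; congr FMonom; elim: w h => //= -[i|//] w IH /= /IH ->.
have inXK (w : {fmonom 'I_n}) : pmap getX [seq inl i | i <- w] = w.
  by elim: (fmonom_val w) => //= i u ->.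
have inX_all (w : {fmonom 'I_n}) : all isX [seq inl i | i <- w].
  by elim: (fmonom_val w).
set m' := FMonom _.
have m'1 : (m' != mone) = (m != mone).
  congr (~~ _); rewrite -!val_eqE /= /m' !fm1.
  by case: m {m'} => -[].
rewrite /Xpart raddf_sum /=.
under eq_bigr do rewrite mcoeffU.
case: ifPn => [/eqP m1|mN1].
  rewrite big1_seq // => w /andP[/andP[w1 wX] _].
  case: eqP => // e; case/negP: w1; apply/eqP.
  rewrite -(getXK w wX); apply: val_inj => /=.
  by move/(congr1 (@fmonom_val _)): e; rewrite m1 !fm1 /= => ->.
case: (boolP (m' \in msupp p)) => [m'p|m'p].
  rewrite big_mkcond (bigD1_seq m') ?fset_uniq //= m'1 mN1 inX_all inXK /=.
  rewrite (_ : FMonom m = m); last exact: val_inj.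
  rewrite eqxx mulr1n big1 ?addr0 // => w ww; case: ifP => // /andP[_ wX].
  by case: eqP => // e; move: ww; rewrite /m' -e /= (getXK w wX) eqxx.
rewrite (mcoeff_outdom m'p) big1_seq // => w /andP[/andP[_ wX] wp].
case: eqP => // e; case/negP: m'p; rewrite /m' -e.
by have := getXK w wX; rewrite /= => ->.
Qed.

Lemma hcompE d p m : (hcomp d p)@_m = if fdeg m == d then p@_m else 0.
Proof.
rewrite /hcomp raddf_sum /=; under eq_bigr do rewrite mcoeffU.
case: (boolP (m \in msupp p)) => [mp|mp]; last first.
  rewrite (mcoeff_outdom mp) if_same big1_seq // => w /andP[_ wp].
  by case: eqP => // e; rewrite -e wp in mp.
case: ifPn => md.
  rewrite big_mkcond (bigD1_seq m) ?fset_uniq //= md eqxx mulr1n.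
  by rewrite big1 ?addr0 // => w /negPf ww; rewrite ww if_same.
by rewrite big1 // => w wd; case: eqP => // e; rewrite -e wd in md.
Qed.

Lemma hcomp_is_linear d : linear (hcomp d).
Proof.
move=> a p q; apply/malgP => m.
by rewrite mcoeffD mcoeffZ !hcompE mcoeffD mcoeffZ; case: ifP; rewrite ?mulr0 ?addr0.
Qed.

End Polynomials.

(* [Add c u d v] is c * u + d * v and [Mul c u d v] is (c * u) * (d * v):
   u, v are the left and right children, c, d the weights of the two edges
   (1 on an unweighted edge). *)
Inductive gate (F : Type) (n : nat) (V : Type) : Type :=
| Var of var n
| Const of F
| Add of F & V & F & V
| Mul of F & V & F & V.
Arguments Var {F n V}.
Arguments Const {F n V}.
Arguments Add {F n V}.
Arguments Mul {F n V}.

Definition gate_map F n V W (f : V -> W) (g : gate F n V) : gate F n W :=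
  match g with
  | Var z => Var z
  | Const c => Const c
  | Add c u d v => Add c (f u) d (f v)
  | Mul c u d v => Mul c (f u) d (f v)
  end.

Definition children F n V (g : gate F n V) : seq V :=
  match g with
  | Var _ | Const _ => [::]
  | Add _ u _ v | Mul _ u _ v => [:: u; v]
  end.

Definition is_mul F n V (g : gate F n V) : bool :=
  if g is Mul _ _ _ _ then true else false.

Definition left_child F n V (g : gate F n V) : option V :=
  match g with
  | Var _ | Const _ => None
  | Add _ u _ _ | Mul _ u _ _ => Some u
  end.

Definition child F n (V : finType) (lab : V -> gate F n V) : rel V :=
  fun u v => v \in children (lab u).

Definition acyclic (V : finType) (e : rel V) : Prop :=
  forall u v, e u v -> ~~ connect e v u.

Record circuit (F : fieldType) (n : nat) := Circuit {
  vertex : finType;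
  label : vertex -> gate F n vertex;
  output : vertex;
  circuit_acyclic : acyclic (child label)
}.

Section Circuits.
Variables (F : fieldType) (n : nat) (Psi : circuit F n).
Notation V := (vertex Psi).

Definition csize : nat := #|V|.

(* Recursion along the graph with explicit fuel. By acyclicity #|V| steps reach
   all leaves (lemma [evalE]), so the default [a0] plays no role. *)
Fixpoint eval_rec A (alg : gate F n A -> A) (a0 : A) (k : nat) (v : V) : A :=
  if k is k'.+1 then alg (gate_map (eval_rec alg a0 k') (label v)) else a0.

Definition eval A (alg : gate F n A -> A) (a0 : A) (v : V) : A :=
  eval_rec alg a0 #|V| v.

Lemma evalE A (alg : gate F n A -> A) a0 v :
  eval alg a0 v = alg (gate_map (eval alg a0) (label v)).
Proof.
pose e := child (@label _ _ Psi).
have card_child u w : e u w -> (#|connect e w| < #|connect e u|)%N.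
  move=> euw; apply/proper_card/properP; split.
    by apply/subsetP => z; apply/connect_trans/connect1.
  by exists u; [apply: connect0 | apply: (@circuit_acyclic _ _ Psi)].
have gate_map_ext (f g : V -> A) u :
    (forall w, e u w -> f w = g w) ->
    gate_map f (label u) = gate_map g (label u).
  by rewrite /e /child; case: (label u) => //= c x d y h;
    rewrite !h // !inE eqxx ?orbT.
have fuel k1 : forall k2 u, (#|connect e u| <= k1)%N -> (#|connect e u| <= k2)%N ->
    eval_rec alg a0 k1 u = eval_rec alg a0 k2 u.
  have pos u : (0 < #|connect e u|)%N by apply/card_gt0P; exists u; apply: connect0.
  have posF u : (#|connect e u| <= 0)%N = false by rewrite leqNgt pos.
  elim: k1 => [|k1 IH] [|k2] u; rewrite ?posF // => h1 h2 /=.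
  by congr alg; apply: gate_map_ext => w /card_child h; apply: IH;
    rewrite -ltnS (leq_trans h).
have le u : (#|connect e u| <= #|V|)%N by apply: max_card.
rewrite {1}/eval (fuel _ #|V|.+1) ?leqW //=.
Qed.

Definition poly_alg (g : gate F n (freeXY F n)) : freeXY F n :=
  match g with
  | Var z => << fmu z >>
  | Const c => c%:MP
  | Add c p d q => c *: p + d *: q
  | Mul c p d q => (c *: p) * (d *: q)
  end.

Definition deg_alg (g : gate F n nat) : nat :=
  match g with
  | Var _ => 1%N
  | Const _ => 0%N
  | Add _ d1 _ d2 => maxn d1 d2
  | Mul _ d1 _ d2 => (d1 + d2)%N
  end.

Definition hat : V -> freeXY F n := eval poly_alg 0.
Definition sdeg : V -> nat := eval deg_alg 0%N.

Definition computes (p : freeXY F n) : Prop := hat (output Psi) = p.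

Definition hatX (g : V) : freeX F n := Xpart (hat g).

Definition degrees : seq nat := sort leq (undup [seq sdeg v | v <- enum V]).
Definition ndegrees : nat := size degrees.

(* l_k, with k counted from 1. *)
Definition ldeg (k : nat) : nat := nth 0%N degrees k.-1.

Definition gatesP (k : nat) : {set V} :=
  [set g | is_mul (label g) && (sdeg g == ldeg k)].

Definition setM (k : nat) : {fset freeX F n} :=
  [fset hatX a | a : V &
     [exists g in gatesP k, left_child (label g) == Some a]]%fset.

Definition setB1 : {fset freeX F n} :=
  (1%R |` [fset << fmu i >> | i : 'I_n])%fset.

(* B_k is meant for k >= 1; the value at k = 0 is a dummy. *)
Fixpoint setB (k : nat) : {fset freeX F n} :=
  match k with
  | 0 => fset0
  | 1 => setB1
  | k'.+1 =>
      (setB k' `|` [fset hatX g | g in gatesP k]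
               `|` [fset p * h | p in setM k, h in setB k'])%fset
  end.

End Circuits.

(* Main.v *)
Require Import Defs.
From mathcomp Require Import all_boot all_order all_algebra finmap.

(** Unfolding the recursion, every element of B_{d'} is a product
    p_1 ... p_r h with p_j in M_{k_j}, k_1 > ... > k_r, and h in the union of
    B_1 and of all the g^_X for product gates g, a set of at most s + n + 1
    elements.  No p_j has a constant term, so such a product has no term of
    degree less than r, and pi_n kills it unless r <= n.  The number of possible
    (p_1, ..., p_r) is at most the r-th elementary symmetric polynomial of the
    |M_k|, hence at most (\sum_k |M_k|)^r / r!; and \sum_k |M_k| <= s, since a
    product gate has a single syntactic degree and a single left child. *)

Import Order.TTheory GRing.Theory Num.Theory.

Local Open Scope ring_scope.

Lemma leq_card_fset (T : choiceType) (A : {fset T}) (s : seq T) :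
  {subset A <= s} -> (#|` A| <= size s)%N.
Proof. by move=> sAs; apply: uniq_leq_size (fset_uniq A) sAs. Qed.

Lemma leq_card_imfset_pred (V : finType) (T : choiceType) (f : V -> T)
    (P : pred V) :
  (#|` [fset f x | x in P]%fset| <= #|P|)%N.
Proof.
rewrite cardE -(size_map f); apply: leq_card_fset => y /imfsetP[x /= Px ->].
by apply: map_f; rewrite mem_enum.
Qed.

(** The first two terms of the binomial expansion, all that the induction in [size_decr_prods]
    needs. *)
Lemma leq_expnD_two_terms (a m r : nat) :
  (a ^ r.+1 + r.+1 * (m * a ^ r) <= (a + m) ^ r.+1)%N.
Proof.
rewrite expnDn !big_ord_recl /= bin0 bin1 mul1n subn0 muln1 !subSS subn0 expn1.
by rewrite addnA mulnCA [(a ^ r * m)%N]mulnC mulnCA leq_addr.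
Qed.

Section DecreasingProducts.
Variables (A : nzRingType) (H : seq A) (M : nat -> seq A).

(* The products p_1 ... p_r h with p_j in M k_j, k > k_1 > ... > k_r, h in H. *)
Fixpoint decr_prods (k r : nat) : seq A :=
  match k, r with
  | 0, 0 => H
  | 0, _.+1 => [::]
  | k'.+1, 0 => decr_prods k' 0
  | k'.+1, r'.+1 =>
      decr_prods k' r'.+1 ++ [seq p * h | p <- M k', h <- decr_prods k' r']
  end.

Lemma decr_prodsS k r : {subset decr_prods k r <= decr_prods k.+1 r}.
Proof. by case: r => [|r] x //= xD; rewrite mem_cat xD. Qed.

Lemma decr_prods0 k : decr_prods k 0 = H.
Proof. by elim: k. Qed.

Lemma decr_prodsM k r p h :
  p \in M k -> h \in decr_prods k r -> p * h \in decr_prods k.+1 r.+1.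
Proof.
move=> pM hD; rewrite /= mem_cat; apply/orP; right.
by apply/allpairsP; exists (p, h).
Qed.

(** Induction on [k], following the recursion e_{r+1}(k+1) = e_{r+1}(k) + |M_k| e_r(k) of elementary
    symmetric polynomials. The factor r! stays on the left to avoid division. *)
Lemma size_decr_prods k r :
  (size (decr_prods k r) * r`! <= size H * (\sum_(i < k) size (M i)) ^ r)%N.
Proof.
elim: k r => [|k IH] [|r] //.
  by rewrite decr_prods0.
rewrite /= size_cat size_allpairs big_ord_recr /=.
apply: leq_trans _ (leq_mul (leqnn _) (leq_expnD_two_terms _ _ _)).
rewrite mulnDl mulnDr leq_add ?IH // factS.
have -> : (size (M k) * size (decr_prods k r) * (r.+1 * r`!) =
           r.+1 * size (M k) * (size (decr_prods k r) * r`!))%N.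
  by rewrite mulnACA [(_ * r.+1)%N]mulnC.
apply: leq_trans (leq_mul (leqnn _) (IH r)) _.
by rewrite mulnCA !mulnA.
Qed.

End DecreasingProducts.

Section LowDegree.
Variables (F : fieldType) (n : nat).
Implicit Types p q : freeX F n.

(** A word of [p * q] concatenates a word of [p], nonempty since [p] has no constant term, and a
    word of [q]. *)
Lemma low_degreeM p q r :
    p@_mone = 0 -> (forall m, m \in msupp q -> (r <= fdeg m)%N) ->
  forall m, m \in msupp (p * q) -> (r.+1 <= fdeg m)%N.
Proof.
move=> p1 qr m /msuppM_le[u [v [up vq ->]]].
rewrite fdegM -add1n leq_add ?qr // lt0n fdeg_eq0.
by apply: contraTneq up => ->; rewrite -mcoeff_neq0 p1 eqxx.
Qed.

Lemma decr_prods_low_degree (H : seq (freeX F n)) M :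
    (forall i p, p \in M i -> p@_mone = 0) ->
  forall k r p m, p \in decr_prods _ H M k r -> m \in msupp p -> (r <= fdeg m)%N.
Proof.
move=> M1; elim=> [|k IH] [|r] p m //=.
rewrite mem_cat => /orP[/IH|/allpairsP[[a b] /= [aM bD ->]]]; first exact.
by apply: low_degreeM => [|u]; [exact: M1 aM | exact: IH bD].
Qed.

Lemma hcomp_neq0_msupp d p : hcomp d p != 0 -> exists2 m, m \in msupp p & fdeg m = d.
Proof.
case: (boolP (has (fun m => fdeg m == d) (msupp p))) => [/hasP[m mp /eqP]|].
  by exists m.
move=> /hasPn no; case/eqP; rewrite /hcomp big1_seq // => m /andP[md mp].
by have := no m mp; rewrite md.
Qed.

End LowDegree.

Section CircuitBasis.
Variables (F : fieldType) (n : nat) (Psi : circuit F n).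

(** All vertices are listed, not only product gates: the cruder list already has length at most s +
    n + 1. *)
Definition base_seq : seq (freeX F n) :=
  enum_fset (setB1 F n) ++ [seq hatX g | g <- enum (vertex Psi)].

(** The shift makes [left_seq k] the set of left factors used in passing from B_k to B_{k+1}. *)
Definition left_seq (k : nat) : seq (freeX F n) := enum_fset (setM Psi k.+1).

Lemma size_base_seq : (size base_seq <= csize Psi + n + 1)%N.
Proof.
rewrite size_cat size_map -cardE addnC -addnA leq_add2l cardfsU1 addnC.
rewrite leq_add ?leq_b1 //.
by apply: leq_trans (leq_card_imfset_pred _ _ _ _) _; rewrite card_ord.
Qed.

Lemma left_seq_const0 k p : p \in left_seq k -> p@_mone = 0.
Proof. by case/imfsetP=> a _ ->; rewrite XpartE eqxx. Qed.

Lemma setB_decr_prods k v :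
  v \in setB Psi k -> exists r, v \in decr_prods _ base_seq left_seq k r.
Proof.
elim: k v => [|k IH] v; first by rewrite in_fset0.
case: k IH => [_ vB|k IH].
  by exists 0%N; rewrite decr_prods0 mem_cat; apply/orP; left.
rewrite !in_fsetU => /orP[/orP[/IH[r vD]|]|].
- by exists r; apply: decr_prodsS.
- case/imfsetP=> g _ ->; exists 0%N.
  by rewrite decr_prods0 mem_cat map_f ?orbT // mem_enum.
case/imfset2P=> p pM [h /IH[r hD] ->].
by exists r.+1; apply: decr_prodsM.
Qed.

Lemma size_left_seq k : (size (left_seq k) <= #|gatesP Psi k.+1|)%N.
Proof.
(* Map each gate to the polynomial of its left child; the default 0 is never taken, product gates
   having one. *)
rewrite cardE -(size_map (fun g => oapp (@hatX F n Psi) 0 (left_child (label g)))).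
apply: leq_card_fset => _ /imfsetP[a /= /existsP[g /andP[gP /eqP ga]] ->].
by apply/mapP; exists g; rewrite ?mem_enum // ga.
Qed.

Lemma sum_size_left_seq :
  (\sum_(i < ndegrees Psi) size (left_seq i) <= csize Psi)%N.
Proof.
apply: leq_trans (_ : (\sum_(i < ndegrees Psi)
  \sum_(g : vertex Psi) (sdeg g == nth 0 (degrees Psi) i) <= _)%N).
  apply: leq_sum => i _; apply: leq_trans (size_left_seq i) _.
  rewrite -sum1_card big_mkcond /=; apply: leq_sum => g _.
  by rewrite inE /ldeg /=; case: eqP; case: is_mul.
rewrite exchange_big /csize -sum1_card; apply: leq_sum => g _.
(* The sum over indices becomes one over the list [degrees Psi]; that list has no duplicates, so [g]
   counts at most once. *)
rewrite -(big_mkord xpredT (fun i => (sdeg g == nth 0 (degrees Psi) i) : nat)).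
rewrite -(big_nth 0 xpredT (fun d => (sdeg g == d) : nat)).
under eq_bigr do rewrite eq_sym.
rewrite -big_mkcond /= sum1_count count_uniq_mem ?leq_b1 //.
by rewrite sort_uniq undup_uniq.
Qed.

End CircuitBasis.

Theorem theorem11 (F : fieldType) (n s : nat) (Psi : circuit F n)
    (size_Psi : csize Psi = s) (Psi_Pal : computes Psi (Pal F n)) :
  (#|` [fset v in setB Psi (ndegrees Psi) | hcomp n v != 0]%fset|)%:R
    <= (s + n + 1)%:R * \sum_(r < n.+1) (s ^ r)%:R / (r`!)%:R :> rat.
Proof.
pose D r := decr_prods _ (base_seq _ _ Psi) (left_seq _ _ Psi) (ndegrees Psi) r.
apply: le_trans (_ : (\sum_(r < n.+1) size (D r))%:R <= _).
  rewrite ler_nat.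
  have -> : (\sum_(r < n.+1) size (D r))%N =
            size (flatten [seq D r | r : 'I_n.+1]).
    by rewrite size_flatten /shape -map_comp sumnE big_map big_enum.
  apply: leq_card_fset => v; rewrite !inE /= => /andP[/setB_decr_prods[r vD]].
  (* A word [m] of degree n in [v] forces r <= n. *)
  case/hcomp_neq0_msupp=> m mv mn; apply/flatten_imageP.
  have rn : (r < n.+1)%N.
    rewrite ltnS -mn.
    by apply: decr_prods_low_degree vD mv; apply: left_seq_const0.
  by exists (Ordinal rn).
rewrite natr_sum mulr_sumr; apply: ler_sum => r _.
rewrite mulrA ler_pdivlMr ?ltr0n ?fact_gt0 // -!natrM ler_nat.
apply: leq_trans (size_decr_prods _ _ _ _ _) _.
(* The case r = 0 is split off because [leq_exp2r] requires a positive exponent. *)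
rewrite -size_Psi leq_mul ?size_base_seq //; case: {D} (nat_of_ord r) => // r'.
by rewrite leq_exp2r // sum_size_left_seq.
Qed.
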